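(* Let $\Omega\subset\mathbb{R}^d$, $d\in\{2,3\}$, be a bounded regular domain, let $\nu>0$, $\Delta t>0$, $t_n=n\Delta t$, and let $(u,p)$ be a sufficiently smooth solution of the Navier--Stokes equations $$u_t+u\cdot\nabla u-\nu\Delta u+\nabla p=f(x,t),\qquad \nabla\cdot u=0\quad\text{in }\Omega,$$ with no-slip boundary condition $u=0$ on $\partial\Omega$. Let $I_H$ be an observation operator with observation spacing $H>0$, producing a velocity field on $\Omega$, such that $$(I_H\phi,\phi)\ge 0\qquad\text{for all }\phi .$$ Let $\chi>0$ be a nudging parameter. Given velocities $w^n$ and $v^n$, let $(w^{n+1},q^{n+1})$ be the non-nudged step, i.e. $\nabla\cdot w^{n+1}=0$, $w^{n+1}=0$ on $\partial\Omega$ and $$\frac{w^{n+1}-w^n}{\Delta t}+w^n\cdot\nabla w^n-\nu\Delta w^{n+1}+\nabla q^{n+1}=f(x,t_{n+1}),$$ and let $(v^{n+1},r^{n+1})$ be the nudged step, i.e. $\nabla\cdot v^{n+1}=0$, $v^{n+1}=0$ on $\partial\Omega$ and $$\frac{v^{n+1}-v^n}{\Delta t}+v^n\cdot\nabla v^n-\nu\Delta v^{n+1}-\chi I_H\bigl(u(t_{n+1})-v^{n+1}\bigr)+\nabla r^{n+1}=f(x,t_{n+1}).$$ Suppose $v^n=w^n$. Then, for any positive $H$ and $\chi$, $$|||u(t_{n+1})-v^{n+1}|||<|||u(t_{n+1})-w^{n+1}|||$$ unless $v^{n+1}=w^{n+1}$ and consequently $I_H(u(t_{n+1})-v^{n+1})\equiv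 0$. Specifically, $$|||u(t_{n+1})-v^{n+1}|||^2+2\Delta t\,\chi\bigl(I_H(u(t_{n+1})-v^{n+1}),\,u(t_{n+1})-v^{n+1}\bigr)+|||v^{n+1}-w^{n+1}|||^2=|||u(t_{n+1})-w^{n+1}|||^2 .$$
   Context: $(\cdot,\cdot)$ and $\|\cdot\|$ denote the $L^2(\Omega)$ inner product and norm. The weighted norm is defined by $|||\phi|||^2:=\|\phi\|^2+\Delta t\,\nu\|\nabla\phi\|^2$. The functions $v^{n},w^{n},v^{n+1},w^{n+1}$ and the associated pressures are assumed regular enough for the equations and integration by parts to make sense. The two time steps use the same time step, viscosity, body force and no-slip boundary conditions.
   Formalization: If v^{n+1}=w^{n+1}, then I_H(u(t_{n+1})-v^{n+1}) is shown L^2-orthogonal to all solenoidal fields, and ≡0 only if it is itself solenoidal (divergence free, zero normal trace); in general it can be a nonzero pressure gradient. *)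

(* Defs.v *)
From HB Require Import structures.
From mathcomp Require Import all_boot all_order all_algebra.
From mathcomp Require Import all_classical all_reals all_analysis.

Set Implicit Arguments.
Unset Strict Implicit.
Unset Printing Implicit Defensive.
Import Order.TTheory GRing.Theory Num.Theory.
Import numFieldNormedType.Exports.
Local Open Scope classical_set_scope.
Local Open Scope ring_scope.

Definition rV_display : measure_display -> measure_display.
Proof. exact. Qed.

Section measurable_rV.
Context {d} {T : sigmaRingType d} (n : nat).

Let coord : 'I_n -> 'rV[T]_n -> T := fun i x => x ord0 i.

Let rV_set0 : g_sigma_preimage coord set0.
Proof. exact: sigma_algebra0. Qed.

Let rV_setC A : g_sigma_preimage coord A -> g_sigma_preimage coord (~` A).
Proof. exact: sigma_algebraC. Qed.

Let rV_bigcup (F : _^nat) : (forall i, g_sigma_preimage coord (F i)) ->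
  g_sigma_preimage coord (\bigcup_i F i).
Proof. exact: sigma_algebra_bigcup. Qed.

(* For T = R this is the Borel sigma-algebra of R^n. *)
HB.instance Definition _ := @isMeasurable.Build (rV_display d)
  'rV[T]_n (g_sigma_preimage coord) rV_set0 rV_setC rV_bigcup.

End measurable_rV.

Section lebesgue_rV.
Context {R : realType}.

Lemma measurable_coord n (i : 'I_n) :
  measurable_fun [set: 'rV[R]_n] (fun x => x ord0 i).
Proof.
move=> _ Y mY; rewrite setTI; apply: sub_sigma_algebra => /=.
rewrite -bigcup_seq/=; exists i => /=; first by rewrite mem_index_enum.
by exists Y => //; rewrite setTI.
Qed.

Lemma measurable_fun_rV d (T : measurableType d) n (f : T -> 'rV[R]_n) :
  (forall i, measurable_fun setT (fun t => f t ord0 i)) ->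
  measurable_fun setT f.
Proof.
move=> mf _ A mA; rewrite setTI.
suff : @measurable _ 'rV[R]_n `<=` [set A | measurable (f @^-1` A)] by apply.
apply: smallest_sub.
  split => /=.
  - by rewrite preimage_set0; exact: measurable0.
  - by move=> B mB; rewrite setTD preimage_setC; exact: measurableC.
  - by move=> F mF; rewrite preimage_bigcup; exact: bigcup_measurable.
rewrite -bigcup_seq => B [i _] [C mC <-] /=; rewrite setTI.
have := mf i measurableT _ mC; rewrite setTI.
by rewrite -comp_preimage.
Qed.

Definition rV_cons n (p : R * 'rV[R]_n) : 'rV[R]_n.+1 :=
  \row_i if unlift ord0 i is Some j then p.2 ord0 j else p.1.

Definition rV_uncons n (x : 'rV[R]_n.+1) : R * 'rV[R]_n :=
  (x ord0 ord0, \row_j x ord0 (lift ord0 j)).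

Lemma rV_consK n : cancel (@rV_cons n) (@rV_uncons n).
Proof.
case=> a x; rewrite /rV_uncons mxE unlift_none; congr pair.
by apply/rowP => j; rewrite !mxE liftK.
Qed.

Lemma measurable_rV_cons n : measurable_fun setT (@rV_cons n).
Proof.
apply: measurable_fun_rV => i.
rewrite (_ : (fun t => _) = fun t : R * 'rV[R]_n =>
    if unlift ord0 i is Some j then t.2 ord0 j else t.1); last first.
  by apply/funext => t; rewrite mxE.
case: unliftP => [j _|_]; last exact: measurable_fst.
apply: (@measurableT_comp _ _ _ _ _ _ (fun x : 'rV[R]_n => x ord0 j)).
  exact: measurable_coord.
exact: measurable_snd.
Qed.

Lemma measurable_rV_uncons n : measurable_fun setT (@rV_uncons n).
Proof.
apply/measurable_fun_pairP; split => /=.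
  exact: measurable_coord.
apply: measurable_fun_rV => i.
rewrite (_ : (fun t => _) = fun t : 'rV[R]_n.+1 => t ord0 (lift ord0 i)).
  exact: measurable_coord.
by apply/funext => t /=; rewrite mxE.
Qed.

Section step.
Variables (n : nat) (m : {sigma_finite_measure set 'rV[R]_n -> \bar R}).

Definition lebesgue_step : set 'rV[R]_n.+1 -> \bar R :=
  pushforward (lebesgue_measure \x m)%E (@rV_cons n).

Let pm : {measure set 'rV[R]_n.+1 -> \bar R} :=
  @measure_function_pushforward__canonical__measure_function_Measure
    _ _ _ _ _ (lebesgue_measure \x m)%E _ (@measurable_rV_cons n).

HB.instance Definition _ := isMeasure.Build _ _ _ lebesgue_step
  (@measure0 _ _ _ pm) (@measure_ge0 _ _ _ pm)
  (@measure_semi_sigma_additive _ _ _ pm).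

Lemma lebesgue_step_sigma_finite : sigma_finite setT lebesgue_step.
Proof.
have /sigma_finiteP[F [FT ndF Foo]] := sigma_finiteT (@lebesgue_measure R).
have /sigma_finiteP[G [GT ndG Goo]] := sigma_finiteT m.
exists (fun k => @rV_uncons n @^-1` (F k `*` G k)).
  apply/esym; rewrite -subTset => x _.
  have [i _ Fi] : (\bigcup_k F k) (x ord0 ord0) by rewrite -FT.
  have [j _ Gj] : (\bigcup_k G k) (rV_uncons x).2 by rewrite -GT.
  exists (maxn i j) => //; split.
    by move: Fi; exact/subsetPset/ndF/leq_maxl.
  by move: Gj; exact/subsetPset/ndG/leq_maxr.
move=> k; have [mF Fk] := Foo k; have [mG Gk] := Goo k; split.
  rewrite -[X in measurable X]setTI; apply: measurable_rV_uncons => //.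
  exact: measurableX.
rewrite /lebesgue_step /pushforward -comp_preimage.
rewrite (_ : @rV_uncons n \o @rV_cons n = id) ?preimage_id.
  by rewrite product_measure1E// lte_mul_pinfty// ge0_fin_numE.
by apply/funext => p /=; rewrite rV_consK.
Qed.

HB.instance Definition _ := Measure_isSigmaFinite.Build _ _ _ lebesgue_step
  lebesgue_step_sigma_finite.
End step.

Fixpoint lebesgue_rV n : {sigma_finite_measure set 'rV[R]_n -> \bar R} :=
  if n is k.+1 then lebesgue_step (lebesgue_rV k) else \d_(0 : 'rV[R]_0).

Lemma lebesgue_rV_box n (A : 'I_n -> set R) :
  (forall i, measurable (A i)) ->
  lebesgue_rV n [set x | forall i, A i (x ord0 i)] =
  (\prod_(i < n) lebesgue_measure (A i))%E.
Proof.
elim: n => [|n ih] in A * => mA.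
  by rewrite big_ord0 /= diracE mem_set// => -[].
have mB : measurable [set x : 'rV[R]_n | forall i, A (lift ord0 i) (x ord0 i)].
  rewrite (_ : [set _ | _] = \bigcap_(i in [set: 'I_n])
      ((fun x : 'rV[R]_n => x ord0 i) @^-1` A (lift ord0 i))); last first.
    by apply/seteqP; split => [x Ax i _|x Ax i]; [exact: Ax|exact: Ax].
  apply: fin_bigcap_measurable => // i _.
  by rewrite -[X in measurable X]setTI; exact: measurable_coord.
rewrite big_ord_recl -ih//= -product_measure1E//; last exact: mA.
rewrite /lebesgue_step /pushforward; congr (product_measure1 _ _).
apply/seteqP; split => [[a x] /= Ax|[a x] /= [A0 Ax] i].
  split; first by have := Ax ord0; rewrite mxE unlift_none.
  by move=> i; have := Ax (lift ord0 i); rewrite mxE liftK.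
by rewrite mxE; case: unliftP => [j ->|->].
Qed.

End lebesgue_rV.

Section sobolev.
Context {R : realType} {d : nat}.
Local Notation E := 'rV[R]_d.
Local Notation leb := (@lebesgue_rV R d).
Variable Omega : set E.

Definition dot (x y : E) : R := \sum_i x ord0 i * y ord0 i.

(* Near each boundary point Omega is the epigraph, in some unit direction e,
   of a Lipschitz function of the component orthogonal to e. *)
Definition lipschitz_boundary : Prop :=
  forall x0 : E, closure Omega x0 -> ~ Omega x0 ->
  exists (e : E) (gamma : E -> R) (r : R),
    [/\ dot e e = 1, lipschitz gamma, 0 < r
      & forall x, ball x0 r x ->
          (Omega x <-> gamma (x - dot x e *: e) < dot x e)].

Definition bounded_regular_domain : Prop :=
  [/\ open Omega, connected Omega, Omega !=set0, bounded_set Omega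
    & lipschitz_boundary].

Definition L2 (f : E -> R) : Prop :=
  measurable_fun Omega f /\
  leb.-integrable Omega (fun x => ((f x) ^+ 2)%:E).

Definition partial (i : 'I_d) (f : E -> R) (x : E) : R :=
  'D_(delta_mx ord0 i) f x.

(* C^1_c(Omega) *)
Definition test_function (eta : E -> R) : Prop :=
  [/\ forall x, differentiable eta x,
      forall i, continuous (partial i eta)
    & exists K : set E, [/\ compact K, K `<=` Omega
                          & forall x, ~ K x -> eta x = 0]].

(* First-order weak derivatives are tested against C^1_c(Omega), and H^1_0 is
   the H^1-closure of C^1_c(Omega), as in Gilbarg and Trudinger; mollification
   shows that C^oo_c(Omega) gives the same notions. *)
Definition weak_partial (i : 'I_d) (f g : E -> R) : Prop :=
  forall eta, test_function eta ->
    \int[leb]_(x in Omega) (f x * partial i eta x) =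
    - \int[leb]_(x in Omega) (g x * eta x).

(* The weak derivative of f in L2, unique up to null sets; 0 if f has none. *)
Definition wD (i : 'I_d) (f : E -> R) : E -> R :=
  xget (fun=> 0) [set g | L2 g /\ weak_partial i f g].

Definition H1 (f : E -> R) : Prop :=
  L2 f /\ forall i, exists g, L2 g /\ weak_partial i f g.

Definition H2 (f : E -> R) : Prop := H1 f /\ forall i, H1 (wD i f).

Definition sqL2 (f : E -> R) : R := \int[leb]_(x in Omega) (f x) ^+ 2.

Definition H10 (f : E -> R) : Prop :=
  H1 f /\ forall eps : R, 0 < eps -> exists eta, test_function eta /\
    sqL2 (fun x => f x - eta x) +
    \sum_i sqL2 (fun x => wD i f x - partial i eta x) < eps.

Definition entry m n (F : E -> 'M[R]_(m, n)) i j : E -> R := fun x => F x i j.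

Definition L2f m n (F : E -> 'M[R]_(m, n)) : Prop :=
  forall i j, L2 (entry F i j).

Definition inner m n (F G : E -> 'M[R]_(m, n)) : R :=
  \int[leb]_(x in Omega) \sum_i \sum_j F x i j * G x i j.

Definition norm2 m n (F : E -> 'M[R]_(m, n)) : R := Num.sqrt (inner F F).

Definition gradp (q : E -> R) (x : E) : E := \row_i wD i q x.

(* Row i is the gradient of the i-th velocity component. *)
Definition grad (v : E -> E) (x : E) : 'M[R]_d :=
  \matrix_(i, j) wD j (entry v ord0 i) x.

Definition laplacian (v : E -> E) (x : E) : E :=
  \row_i \sum_j wD j (wD j (entry v ord0 i)) x.

Definition divergence (v : E -> E) (x : E) : R :=
  \sum_i wD i (entry v ord0 i) x.

(* advect v w is v . grad w *)
Definition advect (v w : E -> E) (x : E) : E :=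
  \row_i \sum_j v x ord0 j * wD j (entry w ord0 i) x.

Definition H1f (v : E -> E) : Prop := forall i, H1 (entry v ord0 i).

Definition H2f (v : E -> E) : Prop := forall i, H2 (entry v ord0 i).

(* v = 0 on the boundary, in the sense of traces *)
Definition no_slip (v : E -> E) : Prop := forall i, H10 (entry v ord0 i).

Definition divergence_free (v : E -> E) : Prop :=
  divergence v = (fun=> 0) %[ae leb in Omega].

(* Square integrable incompressible velocity fields with zero normal component
   on the boundary: no derivative of z is needed for this weak form. A field
   orthogonal to all of them acts on velocities as a pressure gradient. *)
Definition solenoidal (z : E -> E) : Prop :=
  L2f z /\ forall psi, H1 psi -> inner z (gradp psi) = 0.

Definition wnorm (nu dt : R) (phi : E -> E) : R :=
  Num.sqrt (norm2 phi ^+ 2 + dt * nu * norm2 (grad phi) ^+ 2).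

(* Strong derivative at t, in L2(Omega), of u restricted to the times in I;
   one-sided when t is an end point of I. *)
Definition time_derivative (I : set R) (u : R -> E -> E) (t : R) (ut : E -> E) :
    Prop :=
  L2f ut /\
  (fun s => norm2 (fun x => (s - t)^-1 *: (u s x - u t x) - ut x))
    @ within I t^' --> (0 : R).

Definition navier_stokes (nu T : R) (f u : R -> E -> E) (p : R -> E -> R) :
    Prop :=
  forall t, 0 < t <= T ->
  [/\ H2f (u t), no_slip (u t), divergence_free (u t), H1 (p t)
    & exists ut, time_derivative [set s | 0 < s <= T] u t ut /\
        (fun x => ut x + advect (u t) (u t) x - nu *: laplacian (u t) x
                  + gradp (p t) x) = f t %[ae leb in Omega]].

Definition plain_step (nu dt : R) (f1 w0 w1 : E -> E) (q1 : E -> R) : Prop :=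
  [/\ H2f w1, no_slip w1, divergence_free w1, H1 q1
    & (fun x => dt^-1 *: (w1 x - w0 x) + advect w0 w0 x
                - nu *: laplacian w1 x + gradp q1 x)
      = f1 %[ae leb in Omega]].

Definition nudged_step (nu dt chi : R) (IH : (E -> E) -> E -> E)
    (f1 u1 v0 v1 : E -> E) (r1 : E -> R) : Prop :=
  [/\ H2f v1, no_slip v1, divergence_free v1, H1 r1
    & (fun x => dt^-1 *: (v1 x - v0 x) + advect v0 v0 x
                - nu *: laplacian v1 x - chi *: IH (u1 - v1) x + gradp r1 x)
      = f1 %[ae leb in Omega]].

(* Only fields of the regularity of u - v are fed to the operator, so it may be
   defined on L2(Omega), on H1(Omega) or through point values. *)
Definition nonnegative_observation (IH : (E -> E) -> E -> E) : Prop :=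
  forall phi, H2f phi -> no_slip phi -> L2f (IH phi) /\ 0 <= inner (IH phi) phi.

End sobolev.

(* Main.v *)
Require Import Defs.
From mathcomp Require Import all_boot all_order all_algebra.
From mathcomp Require Import all_classical all_reals all_analysis.
From mathcomp Require Import measurable_realfun ring lra.
Import Order.TTheory GRing.Theory Num.Theory.
Import numFieldNormedType.Exports.
Local Open Scope classical_set_scope.
Local Open Scope ring_scope.

Set Implicit Arguments.
Unset Strict Implicit.
Unset Printing Implicit Defensive.

(** Subtracting the two momentum equations removes everything that the two
    steps share, including the convection terms, since v0 and w0 agree almost
    everywhere.  With e = u - v1 and delta = v1 - w1 this leaves
      chi I_H(e) = delta / dt - nu (Lap v1 - Lap w1) + grad (r1 - q1).
    Testing with e, which vanishes on the boundary and is divergence free,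
    removes the pressures and integrates the Laplacians by parts, so that
      (delta, e) + dt nu (grad delta, grad e) = dt chi (I_H(e), e)
    ([nudging_energy]).  As u - w1 = e + delta, expanding the square of the
    weighted norm gives the claimed identity ([energy_expand]); strictness is
    then the positivity of the norm of delta.  If delta = 0, the displayed
    equation says that I_H(e) is a gradient, hence orthogonal to solenoidal
    fields ([nudging_orthogonal]).

    The analytic content lies in the weak derivative [wD], which is a chosen
    representative: its linearity holds only almost everywhere and rests on
    the uniqueness of weak derivatives.  That in turn is the fundamental lemma
    of the calculus of variations ([fundamental_lemma]): a function whose
    integral against all test functions vanishes is zero almost everywhere.
    It is proved by exhibiting the indicator of any open set as a pointwise
    limit of C^1 functions with compact support in that set ([ramp]), which
    shows that the integral over every open subset of the domain vanishes, and
    by Dynkin's pi-lambda theorem.  Integration by parts against H^1_0 functions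
    ([ibp_H10]) is the definition of the weak derivative passed to the limit
    along approximating test functions. *)

(** * A C^1 cut-off on the line and C^1 functions on R^d *)

Section squared_positive_part.
Context {R : realType}.
Implicit Types t h : R.

Definition pos2 t : R := (Num.max 0 t) ^+ 2.

Lemma pos2_gt0 t : (0 < pos2 t) = (0 < t).
Proof.
rewrite /pos2; case: (leP t 0) => t0; first by rewrite expr0n ltxx.
by rewrite exprn_gt0.
Qed.

Lemma pos2_ge0 t : 0 <= pos2 t.
Proof. exact: sqr_ge0. Qed.

Lemma pos2_le1 t : t <= 1 -> pos2 t <= 1.
Proof.
by move=> t1; rewrite /pos2; case: (leP t 0) => t0; nra.
Qed.

(** One quadratic estimate, uniform in [t], gives the derivative on both sides
    of the kink at 0 and at the kink itself. *)
Lemma pos2_taylor t h :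
  `|pos2 (h + t) - pos2 t - h * (2 * Num.max 0 t)| <= h ^+ 2.
Proof.
rewrite /pos2 ler_norml.
by case: (leP t 0) => t0; case: (leP (h + t) 0) => ht0; apply/andP; split; nra.
Qed.

Lemma is_derive_pos2 t : is_derive t 1 pos2 (2 * Num.max 0 t).
Proof.
have cv : (fun h => h^-1 *: (pos2 (h *: 1 + t) - pos2 t)) @ 0^' -->
    (2 * Num.max 0 t : R).
  apply/cvgrPdist_le => e e0; near=> h.
  have h0 : h != 0 by near: h; exact: nbhs_dnbhs_neq.
  have he : `|h| <= e by near: h; apply: dnbhs0_le.
  rewrite distrC -(@ler_pM2l _ `|h|) ?normr_gt0// -normrM mulrBr.
  rewrite /GRing.scale /= mulrA divff// mul1r mulr1.
  apply: (le_trans (pos2_taylor t h)).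
  by rewrite -[leLHS]ger0_norm ?sqr_ge0// expr2 normrM ler_pM2l ?normr_gt0.
apply: DeriveDef.
  by apply/cvg_ex; eexists; exact: cv.
exact: cvg_lim cv.
Unshelve. all: by end_near.
Qed.

End squared_positive_part.

Section C1_functions.
Context {R : realType} {d : nat}.
Local Notation E := 'rV[R]_d.
Implicit Types f g : E -> R.

Definition C1 f : Prop :=
  (forall x, differentiable f x) /\ forall i, continuous (partial i f).

Lemma C1_continuous f : C1 f -> continuous f.
Proof. by move=> [df _] x; exact/differentiable_continuous/df. Qed.

Lemma C1_cst (c : R) : C1 (fun=> c).
Proof.
split=> [x|i]; first exact: differentiable_cst.
rewrite (_ : partial i _ = fun=> 0); first exact: cst_continuous.
by apply/funext => x; rewrite /partial derive_cst.
Qed.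

Lemma partialD i f g x : differentiable f x -> differentiable g x ->
  partial i (fun y => f y + g y) x = partial i f x + partial i g x.
Proof. by move=> df dg; rewrite /partial deriveD//; exact: diff_derivable. Qed.

Lemma partialZ i c f x : differentiable f x ->
  partial i (fun y => c * f y) x = c * partial i f x.
Proof. by move=> df; rewrite /partial (@deriveZ _ _ _ f)//; exact: diff_derivable. Qed.

Lemma C1D f g : C1 f -> C1 g -> C1 (fun x => f x + g x).
Proof.
move=> [df cf] [dg cg]; split=> [x|i].
  exact: differentiableD.
rewrite (_ : partial i _ = fun x => partial i f x + partial i g x).
  by move=> x; exact: (cvgD (cf i x) (cg i x)).
by apply/funext => x; exact: partialD.
Qed.

Lemma C1Z c f : C1 f -> C1 (fun x => c * f x).
Proof.
move=> [df cf]; split=> [x|i]; first exact: (@differentiableZ _ _ _ f).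
rewrite (_ : partial i _ = fun x => c * partial i f x).
  by move=> x; exact: (cvgM (cvg_cst c) (cf i x)).
by apply/funext => x; exact: partialZ.
Qed.

Lemma C1_sum (I : Type) (s : seq I) (F : I -> E -> R) :
  (forall i, C1 (F i)) -> C1 (fun x => \sum_(i <- s) F i x).
Proof.
move=> CF; elim: s => [|i s ih].
  rewrite (_ : (fun _ => _) = fun=> 0); first exact: C1_cst.
  by apply/funext => x; rewrite big_nil.
rewrite (_ : (fun _ => _) = fun x => F i x + \sum_(j <- s) F j x).
  exact: C1D.
by apply/funext => x; rewrite big_cons.
Qed.

Lemma C1_coord i : C1 (fun x : E => x ord0 i).
Proof.
split=> [x|j]; first exact: differentiable_coord.
rewrite (_ : partial j _ = fun=> (j == i)%:R); first exact: cst_continuous.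
apply/funext => x; rewrite /partial /derive.
rewrite (_ : (fun h => _) = (fun h : R => h^-1 * (h * (j == i)%:R))).
  apply: lim_near_cst => //; near=> h.
  rewrite mulrA mulVf ?mul1r//.
  by near: h; exact: nbhs_dnbhs_neq.
apply/funext => h /=; rewrite !mxE eqxx /= addrK.
by rewrite (eq_sym j).
Unshelve. all: by end_near.
Qed.

Lemma C1_comp (phi phi' : R -> R) f : C1 f ->
  (forall t : R, is_derive t 1 phi (phi' t)) -> continuous phi' ->
  C1 (fun x => phi (f x)).
Proof.
move=> [df cf] dphi cphi'.
have dphi1 t : differentiable phi t.
  by apply/derivable1_diffP; have [] := dphi t.
split=> [x|i]; first exact: (@differentiable_comp _ _ _ _ f phi).
rewrite (_ : partial i _ = fun x => partial i f x * phi' (f x)).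
  move=> x; apply: (cvgM (cf i x)).
  apply: (@continuous_comp _ _ _ f phi'); last exact: cphi'.
  exact/differentiable_continuous/df.
apply/funext => x; rewrite /partial deriveE; last exact: (@differentiable_comp _ _ _ _ f phi).
rewrite (@diff_comp _ _ _ _ f phi)//= (deriveE _ (df x)) deriv1E; last first.
  by have [] := dphi (f x).
by rewrite /GRing.scale /= derive1E (@derive_val _ _ _ _ _ _ _ (dphi (f x))).
Qed.

Lemma C1_sqr f : C1 f -> C1 (fun x => f x ^+ 2).
Proof.
move=> Cf; apply: (@C1_comp (fun t => t ^+ 2) (fun t => 2 * t)) => //.
  move=> t; apply: DeriveDef; first exact: exprn_derivable.
  by rewrite -derive1E exp_derive1 expr1 [LHS]scaler_nat mulr_natl.
by move=> t; exact: (cvgM (cvg_cst _) cvg_id).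
Qed.

Lemma C1_pos2 f : C1 f -> C1 (fun x => pos2 (f x)).
Proof.
move=> Cf; apply: C1_comp Cf is_derive_pos2 _.
move=> t; apply: (cvgM (cvg_cst _)).
by apply: (@continuous_max _ _ (fun=> 0) id); [exact: cvg_cst|exact: cvg_id].
Qed.

End C1_functions.

(** * Countably many bumps exhausting an open set *)

Section bumps.
Context {R : realType} {d : nat}.
Local Notation E := 'rV[R]_d.
Implicit Types (x y c : E) (r : R) (U : set E) (k n m : nat).

Definition sqdist c x : R := \sum_(i < d) (x ord0 i - c ord0 i) ^+ 2.

Definition cball c r : set E := [set x | sqdist c x <= r ^+ 2].

Definition bump c r x : R := pos2 (r ^+ 2 - sqdist c x).

Lemma C1_sqdist c : C1 (sqdist c).
Proof.
apply: C1_sum => i; apply: C1_sqr.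
exact: (C1D (C1_coord i) (C1_cst (- c ord0 i))).
Qed.

Lemma C1_bump c r : C1 (bump c r).
Proof.
apply: C1_pos2; apply: C1D; first exact: C1_cst.
rewrite (_ : (fun _ => _) = fun x => -1 * sqdist c x); last first.
  by apply/funext => x; rewrite mulN1r.
exact/C1Z/C1_sqdist.
Qed.

Lemma cball_coord c r x i : 0 <= r -> cball c r x -> `|x ord0 i - c ord0 i| <= r.
Proof.
move=> r0 cx; rewrite -ler_sqr ?nnegrE// real_normK ?num_real//.
apply: le_trans cx; rewrite /sqdist (bigD1 i)//= lerDl.
by apply: sumr_ge0 => j _; exact: sqr_ge0.
Qed.

Lemma rV_norm_le (x : E) r : 0 <= r -> (forall i, `|x ord0 i| <= r) -> `|x| <= r.
Proof.
move=> r0 xr; rewrite [leLHS]/Num.norm /= mx_normrE.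
by apply/bigmax_leP; split => // -[i j] _ /=; rewrite ord1.
Qed.

Lemma cball_compact c r : 0 <= r -> compact (cball c r).
Proof.
move=> r0; apply: bounded_closed_compact.
  exists (`|c| + r); split => [|M /ltW cM x cx]; first exact: num_real.
  apply: le_trans cM; rewrite -(subrK c x) addrC.
  apply: le_trans (ler_normD _ _) _; rewrite lerD2l.
  by apply: rV_norm_le => // i; rewrite !mxE; exact: cball_coord.
rewrite (_ : cball c r = sqdist c @^-1` [set t | t <= r ^+ 2])//.
apply: closed_comp; last exact: closed_le.
by move=> x _; exact: C1_continuous (C1_sqdist c) x.
Qed.

(** The bump on the [k]-th ball with rational centre and radius 1/(m+1), when
    the closed ball lies in [U].  Euclidean rather than sup-norm balls, so that
    the bump is a C^1 function of a polynomial. *)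
Definition tent U k : E -> R :=
  if unpickle k is Some (q, m) then
    let c := map_mx ratr (q : 'rV[rat]_d) in let r := m.+1%:R^-1 in
    if `[< cball c r `<=` U >] then bump c r else fun=> 0
  else fun=> 0.

Lemma C1_tent U k : C1 (tent U k).
Proof.
rewrite /tent; case: unpickle => [[q m]|]; last exact: C1_cst.
by case: ifP => _; [exact: C1_bump|exact: C1_cst].
Qed.

Lemma tent_ge0 U k x : 0 <= tent U k x.
Proof.
rewrite /tent; case: unpickle => [[q m]|]//.
by case: ifP => _ //; exact: pos2_ge0.
Qed.

Lemma tent_support U k :
  exists K, [/\ compact K, K `<=` U & forall x, ~ K x -> tent U k x = 0].
Proof.
rewrite /tent; case: unpickle => [[q m]|]; last first.
  by exists set0; split => //; exact: compact0.
case: ifP => [/asboolP sU|_]; last by exists set0; split => //; exact: compact0.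
exists (cball (map_mx ratr q) m.+1%:R^-1); split => //.
  by apply: cball_compact; rewrite invr_ge0.
move=> x /negP; rewrite -ltNge => xr; apply/eqP; rewrite eq_le pos2_ge0 andbT.
by rewrite leNgt pos2_gt0 subr_gt0 -leNgt ltW.
Qed.

Lemma tent_out U k x : ~ U x -> tent U k x = 0.
Proof.
by have [K [_ KU K0]] := tent_support U k; move=> Ux; apply: K0 => /KU.
Qed.

(** Around a point of [U], take a ball of radius [r] with a rational centre at
    sup-distance less than r/(d+1): its Euclidean distance is then less than
    [r], because d/(d+1)^2 < 1. *)
Lemma tent_cover U x : open U -> U x -> exists k, 0 < tent U k x.
Proof.
move=> oU Ux.
have /nbhs_ballP[e /= e0 eU] : nbhs x U by exact: open_nbhs_nbhs.
have [m] := ltr_add_invr (divr_gt0 e0 (ltr0Sn R 1)).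
rewrite add0r; set r : R := m.+1%:R^-1 => re.
have r0 : 0 < r by rewrite invr_gt0.
pose del := r / d.+1%:R.
have d0 : 0 < del by rewrite divr_gt0.
have dr : d%:R * del ^+ 2 < r ^+ 2.
  rewrite /del expr_div_n mulrCA gtr_pMr ?exprn_gt0//.
  by rewrite ltr_pdivrMr ?exprn_gt0// mul1r -natrX ltr_nat -mulnn leq_pmulr.
have drr : del <= r by rewrite /del ler_pdivrMr// ler_peMr ?ler1n// ltW.
have /choice[q qP] : forall i : 'I_d, exists q : rat, `|x ord0 i - ratr q| < del.
  move=> i; have : x ord0 i - del < x ord0 i + del by lra.
  move=> /rat_in_itvoo[q]; rewrite in_itv/= => /andP[q1 q2].
  by exists q; rewrite ltr_norml; apply/andP; split; lra.
exists (pickle (\row_i q i, m)); rewrite /tent pickleK.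
rewrite asboolT; last first.
  move=> y /(cball_coord _ (ltW r0)) yc; apply: eU; rewrite mx_norm_ball /ball_ /=.
  apply: (@le_lt_trans _ _ (r + r)); last lra.
  apply: rV_norm_le; first lra.
  move=> i; rewrite !mxE; have := yc i; have := qP i; rewrite !mxE.
  by rewrite !ler_norml ltr_norml => /andP[? ?] /andP[? ?]; apply/andP; split; lra.
rewrite pos2_gt0 subr_gt0; apply: le_lt_trans dr.
rewrite /sqdist; apply: (@le_trans _ _ (\sum_(i < d) del ^+ 2)).
  apply: ler_sum => i _; rewrite !mxE -real_normK ?num_real//.
  by rewrite ler_sqr ?nnegrE ?(ltW d0)// ltW.
by rewrite sumr_const card_ord mulr_natl.
Qed.

End bumps.

(** * Test functions converging to the indicator of an open set *)

Section ramps.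
Context {R : realType} {d : nat}.
Local Notation E := 'rV[R]_d.
Local Notation leb := (@lebesgue_rV R d).
Implicit Types (x : E) (U Omega : set E) (k n : nat).

Definition tents U n x : R := \sum_(k < n) tent U k x.

(** Equal to 0 where [tents U n] vanishes and to 1 where it is at least 1/n. *)
Definition ramp U n x : R := 1 - pos2 (1 - n%:R * tents U n x).

Lemma tents_ge0 U n x : 0 <= tents U n x.
Proof. by apply: sumr_ge0 => k _; exact: tent_ge0. Qed.

Lemma C1_ramp U n : C1 (ramp U n).
Proof.
have C1B (f : E -> R) : C1 f -> C1 (fun x => 1 - f x).
  move=> Cf; apply: (C1D (C1_cst 1)).
  rewrite (_ : (fun _ => _) = fun x => -1 * f x); first exact: C1Z.
  by apply/funext => x; rewrite mulN1r.
apply: (C1B (fun x => pos2 (1 - n%:R * tents U n x))).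
apply/C1_pos2/(C1B (fun x => n%:R * tents U n x))/C1Z.
by apply: C1_sum => k; exact: C1_tent.
Qed.

Lemma ramp_ge0 U n x : 0 <= ramp U n x.
Proof.
rewrite subr_ge0; apply: pos2_le1; rewrite gerBl mulr_ge0//.
exact: tents_ge0.
Qed.

Lemma ramp_le1 U n x : ramp U n x <= 1.
Proof. by rewrite gerBl pos2_ge0. Qed.

Lemma ramp_eq0 U n x : tents U n x = 0 -> ramp U n x = 0.
Proof.
by rewrite /ramp => ->; rewrite mulr0 subr0 /pos2 max_r// expr1n subrr.
Qed.

Lemma ramp_out U n x : ~ U x -> ramp U n x = 0.
Proof.
by move=> Ux; apply: ramp_eq0; apply: big1 => k _; exact: tent_out.
Qed.

Lemma ramp_in U x : open U -> U x -> \forall n \near \oo, ramp U n x = 1.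
Proof.
move=> oU Ux; have [k k0] := tent_cover oU Ux.
near=> n.
have nk : (k < n)%N by near: n; exists k.+1.
have tn : tent U k x <= tents U n x.
  rewrite /tents (bigD1 (Ordinal nk))//= lerDl.
  by apply: sumr_ge0 => j _; exact: tent_ge0.
have n1 : 1 <= n%:R * tent U k x.
  rewrite -ler_pdivrMr// mul1r.
  by near: n; exact: nbhs_infty_ger.
rewrite /ramp /pos2 max_l ?expr0n ?subr0//.
rewrite subr_le0; apply: (le_trans n1); exact: ler_wpM2l.
Unshelve. all: by end_near.
Qed.

Lemma ramp_cvg U x : open U -> ramp U ^~ x @ \oo --> (\1_U x : R).
Proof.
move=> oU; apply: cvg_near_cst; have [Ux|Ux] := pselect (U x).
  by rewrite indicE mem_set//; exact: ramp_in.
by apply: nearW => n; rewrite indicE memNset// ramp_out.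
Qed.

Lemma test_function_ramp Omega U n : U `<=` Omega -> test_function Omega (ramp U n).
Proof.
move=> UO; have [dr cr] := C1_ramp U n.
split=> //; have /choice[K KP] := tent_support U.
exists (\big[setU/set0]_(k < n) K k); split.
- by apply: bigsetU_compact => k _; have [] := KP k.
- apply: subset_trans UO; rewrite -bigcup_mkord => x [k _ Kx].
  by have [_ /(_ _ Kx)] := KP k.
- move=> x Kx; apply: ramp_eq0; apply: big1 => k _.
  have [_ _] := KP k; apply => Kkx; apply: Kx.
  by rewrite -bigcup_mkord; exists k => //=.
Qed.

Lemma measurable_tent U k : measurable_fun setT (tent U k).
Proof.
rewrite /tent; case: unpickle => [[q m]|]; last exact: measurable_cst.
case: ifP => _; last exact: measurable_cst.
rewrite /bump /pos2; apply: measurable_funX.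
apply: (measurable_maxr (f := fun=> 0)); first exact: measurable_cst.
apply: measurable_funB; first exact: measurable_cst.
rewrite /sqdist; apply: measurable_sum => i.
apply: measurable_funX; apply: measurable_funB; last exact: measurable_cst.
exact: measurable_coord.
Qed.

(** The sigma-algebra on row vectors is generated by the coordinates, so the
    measurability of open sets needs a countable cover: here, by tents. *)
Lemma open_measurable_rV U : open U -> measurable U.
Proof.
move=> oU; rewrite (_ : U = \bigcup_k (tent U k @^-1` [set t | 0 < t])).
  apply: bigcup_measurable => k _; rewrite -[X in measurable X]setTI.
  apply: measurable_tent => //.
  rewrite (_ : [set t | 0 < t] = `]0, +oo[%classic)//.
  by apply/seteqP; split => t /=; rewrite in_itv/= andbT.
apply/seteqP; split => [x Ux|x [k _ /=]].
  by have [k k0] := tent_cover oU Ux; exists k.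
by apply: contraPP => Ux; rewrite tent_out// ltxx.
Qed.

Lemma continuous_measurable_rV (f : E -> R) : continuous f -> measurable_fun setT f.
Proof.
move=> /continuousP cf; apply: (measurability _ (RGenOpens.measurableE R)).
move=> _ [_ [a [b ->] <-]]; rewrite setTI; apply: open_measurable_rV.
exact/cf/interval_open.
Qed.

Lemma C1_measurable (A : set E) (f : E -> R) : C1 f -> measurable_fun A f.
Proof.
move=> Cf; apply: measurable_funTS; apply: continuous_measurable_rV.
exact: C1_continuous.
Qed.

Lemma measurable_rV_open : @measurable _ E = <<s (@open E) >>.
Proof.
apply/seteqP; split; last first.
  apply: smallest_sub; first exact: sigma_algebra_measurable.
  exact: open_measurable_rV.
apply: smallest_sub; first exact: smallest_sigma_algebra.
rewrite -bigcup_seq => _ [i _] [C mC <-]; rewrite setTI.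
have : measurable_fun [set: g_sigma_algebraType (@open E)]
    (fun x : g_sigma_algebraType (@open E) => (x : E) ord0 i).
  apply: (measurability _ (RGenOpens.measurableE R)).
  move=> _ [_ [a [b ->] <-]]; rewrite setTI; apply: sub_sigma_algebra.
  apply: open_comp; last exact: interval_open.
  by move=> x _; exact: coord_continuous.
by move=> /(_ measurableT _ mC); rewrite setTI.
Qed.

End ramps.

(** * The fundamental lemma of the calculus of variations *)

Section fundamental_lemma.
Context {R : realType} {d : nat}.
Local Notation E := 'rV[R]_d.
Local Notation leb := (@lebesgue_rV R d).
Variable Omega : set E.
Hypothesis oO : open Omega.
Let mO : measurable Omega := open_measurable_rV oO.

Section vanishing.
Variable g : E -> R.
Hypothesis ig : leb.-integrable Omega (EFin \o g).
Hypothesis g0 : forall eta, test_function Omega eta ->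
  \int[leb]_(x in Omega) (g x * eta x) = 0.

Let mg : measurable_fun Omega g.
Proof. by apply/measurable_EFinP; exact: measurable_int ig. Qed.

(* Dominated convergence along the ramps of [Omega `&` U]. *)
Let int_open U : open U -> (\int[leb]_(x in Omega `&` U) (g x)%:E = 0)%E.
Proof.
move=> oU; set V := Omega `&` U.
have oV : open V by exact: openI.
have mr n : measurable_fun Omega (fun x => (g x * ramp V n x)%:E).
  apply/measurable_EFinP; apply: measurable_funM => //.
  exact: C1_measurable (C1_ramp V n).
have gr n x : (`|(g x * ramp V n x)%:E| <= `|(g x)%:E|)%E.
  rewrite lee_fin normrM ler_piMr// ger0_norm ?ramp_ge0//.
  exact: ramp_le1.
have cv : (\int[leb]_(x in Omega) (g x * ramp V n x)%:E)%E @[n --> \oo] -->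
    (\int[leb]_(x in Omega) (g x * \1_V x)%:E)%E.
  apply: (@dominated_cvg _ _ _ leb Omega mO (fun n x => (g x * ramp V n x)%:E)
    (fun x => (g x * \1_V x)%:E) (fun x => `|(g x)%:E|%E)) => //.
  - move=> x _; apply: cvg_EFin; first exact: nearW.
    by apply: (cvgM (cvg_cst _)); exact: ramp_cvg.
  - exact: integrable_abse.
rewrite -[LHS](_ : (\int[leb]_(x in Omega) (g x * \1_V x)%:E)%E = _).
  rewrite -(cvg_lim _ cv)//; apply: lim_near_cst => //; apply: nearW => n.
  have ir : leb.-integrable Omega (fun x => (g x * ramp V n x)%:E).
    by apply: le_integrable ig => // x _; exact: gr.
  rewrite -[LHS]fineK; last exact: integrable_fin_num.
  by congr EFin; exact: g0 (test_function_ramp n (@subIsetl _ Omega U)).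
rewrite integral_mkcondr; apply: eq_integral => x Ox.
rewrite /V indicE in_setI Ox patchE /=.
by case: ifP; rewrite ?mulr1 ?mulr0.
Qed.

Let int_measurable S : measurable S -> (\int[leb]_(x in Omega `&` S) (g x)%:E = 0)%E.
Proof.
rewrite {1}measurable_rV_open.
apply: (dynkin_induction (P := fun S => \int[leb]_(x in Omega `&` S) (g x)%:E = 0)%E).
- exact: measurable_rV_open.
- exact: openI.
- exact/int_open/openT.
- by move=> U; exact: int_open.
- move=> A mA A0.
  have := int_open openT; rewrite -(setUv A) setIUr integral_setU//=.
  + by rewrite A0 add0e.
  + exact: measurableI.
  + by apply: measurableI => //; exact: measurableC.
  + rewrite -setIUr setUv setIT; exact/measurable_EFinP.
  + by apply/disj_setPS => x [[_ Ax] [_]].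
- move=> F mF tF F0; rewrite setI_bigcupr integral_bigcup//.
  + by apply: eseries0 => k _ _; exact: F0.
  + exact: trivIset_setIl.
  + by move=> k; exact: measurableI.
  + apply: integrableS ig => //; last by rewrite -setI_bigcupr.
    by apply: bigcup_measurable => k _; exact: measurableI.
Qed.

Lemma fundamental_lemma : g = (fun=> 0) %[ae leb in Omega].
Proof.
have : ae_eq leb Omega (EFin \o g) (cst 0%E).
  apply: integral_ae_eq => //.
  move=> A AO mA; rewrite integral_cst// mul0e.
  by rewrite -(setIidr AO); exact: int_measurable.
apply: filterS => x H Ox; have := H Ox; by case.
Qed.

End vanishing.

End fundamental_lemma.

(** * Square integrable functions on a bounded open set *)

Section L2_theory.
Context {R : realType} {d : nat}.
Local Notation E := 'rV[R]_d.
Local Notation leb := (@lebesgue_rV R d).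
Variable Omega : set E.
Hypothesis oO : open Omega.
Hypothesis bO : bounded_set Omega.
Implicit Types f g h : E -> R.
Let mO : measurable Omega := open_measurable_rV oO.

Definition ip f g : R := \int[leb]_(x in Omega) (f x * g x).

Lemma ipE f g : ip f g = \int[leb]_(x in Omega) (f x * g x).
Proof. by []. Qed.

Lemma L2M_integrable f g : L2 Omega f -> L2 Omega g ->
  leb.-integrable Omega (EFin \o (fun x => f x * g x)).
Proof.
move=> [mf if2] [mg ig2].
apply: le_integrable (integrableD mO if2 ig2) => //.
  by apply/measurable_EFinP; exact: measurable_funM.
move=> x _ /=; rewrite lee_fin [leRHS]ger0_norm ?addr_ge0 ?sqr_ge0//.
by rewrite ler_norml; apply/andP; split; nra.
Qed.

Lemma L2D f g : L2 Omega f -> L2 Omega g -> L2 Omega (fun x => f x + g x).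
Proof.
move=> Lf Lg; have [mf if2] := Lf; have [mg ig2] := Lg.
split; first exact: measurable_funD.
apply: eq_integrable (integrableD mO (integrableD mO if2 ig2)
  (integrableZl mO 2 (L2M_integrable Lf Lg))) => // x _ /=.
by congr EFin; ring.
Qed.

Lemma L2Z a f : L2 Omega f -> L2 Omega (fun x => a * f x).
Proof.
move=> [mf if2]; split; first exact: measurable_funM.
apply: eq_integrable (integrableZl mO (a ^+ 2) if2) => // x _ /=.
by congr EFin; rewrite exprMn.
Qed.

Lemma L2B f g : L2 Omega f -> L2 Omega g -> L2 Omega (fun x => f x - g x).
Proof.
move=> Lf Lg; rewrite (_ : (fun _ => _) = fun x => f x + -1 * g x).
  by apply: L2D => //; exact: L2Z.
by apply/funext => x; rewrite mulN1r.
Qed.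

Lemma L2_0 : L2 Omega (fun=> 0).
Proof.
split; first exact: measurable_cst.
by apply: eq_integrable (integrable0 leb Omega) => // x _; rewrite expr0n.
Qed.

Lemma L2_sum (I : Type) (s : seq I) (F : I -> E -> R) :
  (forall i, L2 Omega (F i)) -> L2 Omega (fun x => \sum_(i <- s) F i x).
Proof.
move=> LF; elim: s => [|i s ih].
  by under eq_fun do rewrite big_nil; exact: L2_0.
by under eq_fun do rewrite big_cons; exact: L2D.
Qed.

Lemma ipC f g : ip f g = ip g f.
Proof. by rewrite /ip; under eq_Rintegral do rewrite mulrC. Qed.

Lemma ipDl f g h : L2 Omega f -> L2 Omega g -> L2 Omega h ->
  ip (fun x => f x + g x) h = ip f h + ip g h.
Proof.
move=> Lf Lg Lh; rewrite /ip -RintegralD//; try exact: L2M_integrable.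
by under eq_Rintegral do rewrite mulrDl.
Qed.

Lemma ipZl a f g : L2 Omega f -> L2 Omega g ->
  ip (fun x => a * f x) g = a * ip f g.
Proof.
move=> Lf Lg; rewrite /ip -RintegralZl//; last exact: L2M_integrable.
by under eq_Rintegral do rewrite -mulrA.
Qed.

Lemma ipBl f g h : L2 Omega f -> L2 Omega g -> L2 Omega h ->
  ip (fun x => f x - g x) h = ip f h - ip g h.
Proof.
move=> Lf Lg Lh; rewrite (_ : (fun x => _) = fun x => f x + -1 * g x).
  by rewrite ipDl ?ipZl ?mulN1r//; exact: L2Z.
by apply/funext => x; rewrite mulN1r.
Qed.

Lemma ipBr f g h : L2 Omega f -> L2 Omega g -> L2 Omega h ->
  ip h (fun x => f x - g x) = ip h f - ip h g.
Proof. by move=> *; rewrite ipC ipBl// !(ipC _ h). Qed.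

Lemma ipDr f g h : L2 Omega f -> L2 Omega g -> L2 Omega h ->
  ip h (fun x => f x + g x) = ip h f + ip h g.
Proof. by move=> *; rewrite ipC ipDl// !(ipC _ h). Qed.

Lemma ipZr a f g : L2 Omega f -> L2 Omega g ->
  ip g (fun x => a * f x) = a * ip g f.
Proof. by move=> *; rewrite ipC ipZl// ipC. Qed.

Lemma Rintegral_sum (I : Type) (s : seq I) (F : I -> E -> R) :
  (forall i, leb.-integrable Omega (EFin \o F i)) ->
  leb.-integrable Omega (EFin \o (fun x => \sum_(i <- s) F i x)) /\
  \int[leb]_(x in Omega) (\sum_(i <- s) F i x) =
  \sum_(i <- s) \int[leb]_(x in Omega) F i x.
Proof.
move=> iF; elim: s => [|i s [ih1 ih2]].
  rewrite big_nil; under eq_fun do rewrite big_nil; split.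
    exact: integrable0.
  by rewrite Rintegral_cst// mul0r.
rewrite big_cons; under eq_fun do rewrite big_cons; split.
  exact: eq_integrable (integrableD mO (iF i) ih1).
by rewrite RintegralD// ih2.
Qed.

Lemma ip_suml (I : Type) (s : seq I) (F : I -> E -> R) g :
  (forall i, L2 Omega (F i)) -> L2 Omega g ->
  ip (fun x => \sum_(i <- s) F i x) g = \sum_(i <- s) ip (F i) g.
Proof.
move=> LF Lg; rewrite /ip -(Rintegral_sum _ _).2.
  by under eq_Rintegral do rewrite mulr_suml.
by move=> i; exact: L2M_integrable.
Qed.

Lemma ip_ge0 f : 0 <= ip f f.
Proof. by apply: Rintegral_ge0 => x _; rewrite -expr2 sqr_ge0. Qed.

Lemma ip_ae f f' g : L2 Omega f -> L2 Omega f' -> L2 Omega g ->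
  f = f' %[ae leb in Omega] -> ip f g = ip f' g.
Proof.
move=> Lf Lf' Lg ff'; rewrite /ip /Rintegral; congr fine.
apply: ae_eq_integral => //;
  try by apply: measurable_int (L2M_integrable _ _).
by apply: filterS ff' => x + Ox; move=> /(_ Ox) ->.
Qed.

Lemma ip_eq0 f : L2 Omega f -> ip f f = 0 -> f = (fun=> 0) %[ae leb in Omega].
Proof.
move=> Lf f0.
have iff := L2M_integrable Lf Lf.
have : (\int[leb]_(x in Omega) `|(f x * f x)%:E| = 0)%E.
  rewrite -[RHS]/(EFin 0) -f0 /ip /Rintegral fineK; last exact: integrable_fin_num.
  by apply: eq_integral => x _; rewrite gee0_abs// lee_fin -expr2 sqr_ge0.
move/(ae_eq_integral_abs leb mO (measurable_int _ iff)).
apply: filterS => x H Ox; have := H Ox; case => /eqP.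
by rewrite mulf_eq0 orbb => /eqP.
Qed.

Lemma ip_sqrD f g : L2 Omega f -> L2 Omega g ->
  ip (fun x => f x + g x) (fun x => f x + g x) = ip f f + 2 * ip g f + ip g g.
Proof.
by move=> Lf Lg; have Lfg := L2D Lf Lg; rewrite ipDl// !ipDr// (ipC f g); ring.
Qed.

Lemma ip_self_ae f g : L2 Omega f -> L2 Omega g -> f = g %[ae leb in Omega] ->
  ip f f = ip g g.
Proof. by move=> Lf Lg fg; rewrite (ip_ae Lf Lg Lf fg) ipC (ip_ae Lf Lg Lg fg). Qed.

Lemma sqL2E f : sqL2 Omega f = ip f f.
Proof. by rewrite /sqL2; under eq_Rintegral do rewrite expr2. Qed.

Lemma sqL2D f g : L2 Omega f -> L2 Omega g ->
  sqL2 Omega (fun x => f x + g x) = sqL2 Omega f + 2 * ip f g + sqL2 Omega g.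
Proof. by move=> Lf Lg; rewrite !sqL2E ip_sqrD// (ipC g f). Qed.

Lemma sqL2Z a f : L2 Omega f -> sqL2 Omega (fun x => a * f x) = a ^+ 2 * sqL2 Omega f.
Proof. by move=> Lf; rewrite !sqL2E ipZl ?ipZr ?mulrA//; exact: L2Z. Qed.

Lemma sqL2B_le f g : L2 Omega f -> L2 Omega g ->
  sqL2 Omega (fun x => f x - g x) <= 2 * sqL2 Omega f + 2 * sqL2 Omega g.
Proof.
move=> Lf Lg; have := sqL2D Lf Lg.
have : 0 <= sqL2 Omega (fun x => f x + g x) by rewrite sqL2E ip_ge0.
rewrite (_ : (fun x => f x - g x) = fun x => f x + -1 * g x); last first.
  by apply/funext => x; rewrite mulN1r.
rewrite (sqL2D Lf (L2Z _ Lg)) sqL2Z// ipZr//; nra.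
Qed.

Lemma sqL2_ae f g : L2 Omega f -> L2 Omega g -> f = g %[ae leb in Omega] ->
  sqL2 Omega f = sqL2 Omega g.
Proof. by move=> Lf Lg fg; rewrite !sqL2E; exact: ip_self_ae. Qed.

(** The right-hand side is the square of the norm of [a * f + g]; the free
    parameter [a] makes this a substitute for the Cauchy-Schwarz inequality. *)
Lemma ip_quadratic a f g : L2 Omega f -> L2 Omega g ->
  0 <= a ^+ 2 * sqL2 Omega f + 2 * a * ip f g + sqL2 Omega g.
Proof.
move=> Lf Lg; have := ip_ge0 (fun x => a * f x + g x).
by rewrite -sqL2E (sqL2D (L2Z a Lf))// sqL2Z// ipZl// mulrA.
Qed.

Lemma bounded_sub_box :
  exists2 M : R, 0 <= M & Omega `<=` [set x | forall i, `|x ord0 i| <= M].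
Proof.
have [M [_ OM]] := bO; exists (`|M| + 1) => [|x Ox i].
  by rewrite addr_ge0.
have : `|x| <= `|M| + 1.
  by apply: (OM (`|M| + 1)) => //; rewrite (le_lt_trans (ler_norm _))// ltrDl.
apply: le_trans; rewrite [leRHS]/Num.norm /= mx_normrE.
exact: (@le_bigmax _ _ _ _ (fun ij : 'I_1 * 'I_d => `|x ij.1 ij.2|) (ord0, i)).
Qed.

Lemma finite_lebesgue_Omega : (leb Omega < +oo)%E.
Proof.
have [M M0 OM] := bounded_sub_box.
pose A (i : 'I_d) : set R := `[- M, M]%classic.
have mA i : measurable (A i) by exact: measurable_itv.
have boxE := lebesgue_rV_box mA.
apply: (@le_lt_trans _ _ (leb [set x | forall i, A i (x ord0 i)])).
  apply: le_measure; rewrite ?inE//.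
    rewrite [X in measurable X](_ : _ =
        \bigcap_(i in [set: 'I_d]) ((fun x : E => x ord0 i) @^-1` A i)); last first.
      by apply/seteqP; split => [x Ax i _|x Ax i]; [exact: Ax|exact: Ax].
    apply: fin_bigcap_measurable => // i _.
    by rewrite -[X in measurable X]setTI; exact: measurable_coord.
  by move=> x Ox i; rewrite /A /= in_itv/= -ler_norml; exact: OM.
rewrite boxE ltey_eq prode_fin_num// => i _.
by rewrite lebesgue_measure_itv; case: ifP.
Qed.

(** On a bounded domain, test functions and their partial derivatives are
    square integrable just because they are continuous on the whole space. *)
Lemma L2_continuous f : continuous f -> L2 Omega f.
Proof.
move=> cf; have mf := measurable_funTS (continuous_measurable_rV cf) : measurable_fun Omega f.
split => //; apply: (measurable_bounded_integrable mO finite_lebesgue_Omega).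
  exact: measurable_funX.
have [M M0 OM] := bounded_sub_box.
have cK : compact [set x : E | forall i, x ord0 i \in `[- M, M]].
  by apply: (@rV_compact _  _ (fun=> `[- M, M]%classic)) => _; exact: segment_compact.
have : compact ((fun x => f x ^+ 2) @` [set x : E | forall i, x ord0 i \in `[- M, M]]).
  apply: continuous_compact cK; apply: continuous_subspaceT => x.
  exact: (cvgM (cf x) (cf x)).
move=> /compact_bounded[N [Nr NP]]; exists N; split => // r Nr' x Ox.
apply: NP Nr' _ _; exists x => // i.
by rewrite in_itv /= -ler_norml; exact: OM.
Qed.

Lemma L2_test eta : test_function Omega eta -> L2 Omega eta.
Proof.
move=> [de ce _]; apply: L2_continuous => x.
exact/differentiable_continuous/de.
Qed.

Lemma L2_partial_test eta i : test_function Omega eta -> L2 Omega (partial i eta).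
Proof. by move=> [_ ce _]; exact: L2_continuous. Qed.

End L2_theory.

(* Unification would otherwise unfold the Lebesgue integral to tell apart two
   inner products; likewise for weak derivatives below. *)
Opaque ip.

(** * Weak derivatives and H^1_0 *)

Section weak_derivatives.
Context {R : realType} {d : nat}.
Local Notation E := 'rV[R]_d.
Local Notation leb := (@lebesgue_rV R d).
Variable Omega : set E.
Hypothesis oO : open Omega.
Hypothesis bO : bounded_set Omega.
Implicit Types f g h : E -> R.
Local Notation ip := (ip Omega).

Lemma wDP i f : H1 Omega f ->
  L2 Omega (wD Omega i f) /\ weak_partial Omega i f (wD Omega i f).
Proof. by move=> [_ /(_ i)]; exact: xgetPex. Qed.

Lemma L2_wD i f : H1 Omega f -> L2 Omega (wD Omega i f).
Proof. by case/(wDP i). Qed.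

Lemma H1_L2 f : H1 Omega f -> L2 Omega f. Proof. by case. Qed.

Lemma weak_partialB i f g df dg : L2 Omega f -> L2 Omega g ->
  L2 Omega df -> L2 Omega dg ->
  weak_partial Omega i f df -> weak_partial Omega i g dg ->
  weak_partial Omega i (fun x => f x - g x) (fun x => df x - dg x).
Proof.
move=> Lf Lg Ldf Ldg wf wg eta teta.
have Le := L2_test oO bO teta; have Lpe := L2_partial_test oO bO i teta.
have := ipBl oO Lf Lg Lpe; rewrite !ipE => ->; rewrite wf// wg//.
by have := ipBl oO Ldf Ldg Le; rewrite !ipE => ->; ring.
Qed.

(** Two weak derivatives have the same integral against all test functions. *)
Lemma weak_partial_unique i f g h : L2 Omega g -> L2 Omega h ->
  weak_partial Omega i f g -> weak_partial Omega i f h ->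
  g = h %[ae leb in Omega].
Proof.
move=> Lg Lh wg wh; have Lgh := L2B oO Lg Lh.
have L1 : L2 Omega (fun=> 1) by exact: (L2_continuous oO bO (C1_continuous (C1_cst 1))).
have : (fun x => g x - h x) = (fun=> 0) %[ae leb in Omega].
  apply: fundamental_lemma => //.
    apply: eq_integrable (L2M_integrable oO Lgh L1) => //.
      exact: open_measurable_rV.
    by move=> x _ /=; rewrite mulr1.
  move=> eta teta; have := ipBl oO Lg Lh (L2_test oO bO teta).
  rewrite !ipE => ->; apply/eqP; rewrite subr_eq0 -eqr_opp; apply/eqP.
  by rewrite -wg// -wh.
by apply: filterS => x H Ox; apply/eqP; rewrite -subr_eq0; apply/eqP; exact: H.
Qed.

Lemma H1B f g : H1 Omega f -> H1 Omega g -> H1 Omega (fun x => f x - g x).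
Proof.
move=> Hf Hg; split; first by apply: L2B => //; exact: H1_L2.
move=> i; have [Lf wf] := wDP i Hf; have [Lg wg] := wDP i Hg.
exists (fun x => wD Omega i f x - wD Omega i g x); split; first exact: L2B.
by apply: weak_partialB => //; exact: H1_L2.
Qed.

Lemma wDB i f g : H1 Omega f -> H1 Omega g ->
  wD Omega i (fun x => f x - g x) = (fun x => wD Omega i f x - wD Omega i g x)
    %[ae leb in Omega].
Proof.
move=> Hf Hg; have [Lf wf] := wDP i Hf; have [Lg wg] := wDP i Hg.
have [Lfg wfg] := wDP i (H1B Hf Hg).
apply: weak_partial_unique wfg _ => //; first exact: L2B.
by apply: weak_partialB => //; exact: H1_L2.
Qed.

Lemma weak_partial_ae i f f' g : L2 Omega f -> L2 Omega f' ->
  f = f' %[ae leb in Omega] ->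
  weak_partial Omega i f g -> weak_partial Omega i f' g.
Proof.
move=> Lf Lf' ff' wf eta teta; rewrite -wf//; apply/esym.
have := ip_ae oO Lf Lf' (L2_partial_test oO bO i teta) ff'.
by rewrite !ipE.
Qed.

(** A plain equality: the sets of weak derivatives from which [wD] chooses
    coincide. *)
Lemma wD_ae i f g : L2 Omega f -> L2 Omega g -> f = g %[ae leb in Omega] ->
  wD Omega i f = wD Omega i g.
Proof.
move=> Lf Lg fg; rewrite /wD; congr xget; apply/seteqP.
split=> h [Lh wh]; split => //; apply: weak_partial_ae wh => //.
by apply: filterS fg => x H Ox; rewrite H.
Qed.

Lemma H1_ae f g : H1 Omega f -> L2 Omega g -> f = g %[ae leb in Omega] ->
  H1 Omega g.
Proof.
move=> Hf Lg fg; split => // i; have [L w] := wDP i Hf.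
exists (wD Omega i f); split => //; apply: weak_partial_ae w => //; exact: H1_L2.
Qed.

(** [wD i (f - g)] agrees only almost everywhere with a difference of H^1
    functions, so that H^1 must be shown stable under such changes. *)
Lemma H2B f g : H2 Omega f -> H2 Omega g -> H2 Omega (fun x => f x - g x).
Proof.
move=> [Hf H2f] [Hg H2g]; split; first exact: H1B.
move=> i; apply: (H1_ae (H1B (H2f i) (H2g i))).
  exact/L2_wD/H1B.
by apply: filterS (wDB i Hf Hg) => x H Ox; rewrite H.
Qed.

Lemma test_functionB eta theta : test_function Omega eta ->
  test_function Omega theta -> test_function Omega (fun x => eta x - theta x).
Proof.
move=> [de ce [K [cK KO K0]]] [dt ct [L [cL LO L0]]].
have [dB cB] : C1 (fun x => eta x + -1 * theta x).
  by apply: C1D => //; exact: C1Z.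
rewrite (_ : (fun x => eta x - theta x) = fun x => eta x + -1 * theta x); last first.
  by apply/funext => x; rewrite mulN1r.
split => //; exists (K `|` L); split; first exact: compactU.
  by rewrite subUset.
by move=> x /not_orP[Kx Lx]; rewrite K0// L0// mulr0 addr0.
Qed.

Lemma partialB i f g x : differentiable f x -> differentiable g x ->
  partial i (fun y => f y - g y) x = partial i f x - partial i g x.
Proof. by move=> df dg; rewrite /partial deriveB//; exact: diff_derivable. Qed.

Lemma H10_H1 f : H10 Omega f -> H1 Omega f. Proof. by case. Qed.

Lemma H10B f g : H10 Omega f -> H10 Omega g -> H10 Omega (fun x => f x - g x).
Proof.
move=> [Hf af] [Hg ag]; split; first exact: H1B.
move=> eps eps0.
have [eta [te eP]] := af (eps / 4) (divr_gt0 eps0 (ltr0Sn R 3)).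
have [theta [tt tP]] := ag (eps / 4) (divr_gt0 eps0 (ltr0Sn R 3)).
have tet := test_functionB te tt.
exists (fun x => eta x - theta x); split=> //.
have Lf := H1_L2 Hf; have Lg := H1_L2 Hg.
have Le := L2_test oO bO te; have Lt := L2_test oO bO tt.
apply: (@le_lt_trans _ _ (2 * sqL2 Omega (fun x => f x - eta x)
    + 2 * sqL2 Omega (fun x => g x - theta x)
  + \sum_i (2 * sqL2 Omega (fun x => wD Omega i f x - partial i eta x)
    + 2 * sqL2 Omega (fun x => wD Omega i g x - partial i theta x)))).
  apply: lerD.
    rewrite (_ : (fun x => f x - g x - _) =
        fun x => (f x - eta x) - (g x - theta x)).
      by apply: sqL2B_le => //; exact: L2B.
    by apply/funext => x; ring.
  apply: ler_sum => i _.
  have Lpe := L2_partial_test oO bO i te; have Lpt := L2_partial_test oO bO i tt.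
  have LDf := L2_wD i Hf; have LDg := L2_wD i Hg.
  rewrite (sqL2_ae oO (g := fun x => (wD Omega i f x - partial i eta x)
      - (wD Omega i g x - partial i theta x))).
  - by apply: sqL2B_le => //; exact: L2B.
  - apply: L2B => //; first exact/L2_wD/H1B.
    exact: L2_partial_test.
  - by apply: L2B => //; exact: L2B.
  - apply: filterS (wDB i Hf Hg) => x H Ox; rewrite H// partialB; first by ring.
      by case: te => /(_ x).
    by case: tt => /(_ x).
have sumE (p q : 'I_d -> R) :
    \sum_i (2 * p i + 2 * q i) = 2 * \sum_i p i + 2 * \sum_i q i.
  by rewrite big_split/= -!mulr_sumr.
rewrite sumE.
have arith (p q r t : R) : p + q < eps / 4 -> r + t < eps / 4 ->
    2 * p + 2 * r + (2 * q + 2 * t) < eps by clear; lra.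
exact: arith eP tP.
Qed.

(** Let A be the difference of the two sides.  A does not change when a test
    function is subtracted from [e], and the squared H^1 norm of what remains
    of [e] can be made smaller than any a^2.  Applying [ip_quadratic] to both
    inner products in A then gives 0 < a^2 C + 2 a A for every nonzero [a],
    with C independent of [a].  If A were nonzero, a = - A / C would
    contradict this. *)
Lemma ibp_H10 i f e : H1 Omega f -> H10 Omega e ->
  ip (wD Omega i f) e = - ip f (wD Omega i e).
Proof.
move=> Hf [He ae]; have [LDf wf] := wDP i Hf.
have Lf := H1_L2 Hf; have Le := H1_L2 He; have LDe := L2_wD i He.
apply/eqP; rewrite -subr_eq0 opprK; apply/negPn/negP.
set A := ip _ e + _ => A0.
pose C := sqL2 Omega (wD Omega i f) + sqL2 Omega f + 1.
have C_ge1 : 1 <= C by rewrite lerDr addr_ge0// sqL2E ip_ge0.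
pose a := - A / C.
have a0 : 0 < a ^+ 2.
  by rewrite exprn_even_gt0//= mulf_neq0 ?oppr_eq0// invr_eq0; apply/eqP; lra.
have [eta [te eP]] := ae _ a0.
have Lt := L2_test oO bO te; have Lpt := L2_partial_test oO bO i te.
have := ip_quadratic oO a LDf (L2B oO Le Lt).
have := ip_quadratic oO a Lf (L2B oO LDe Lpt).
rewrite !ipBr//.
have w0 : ip (wD Omega i f) eta = - ip f (partial i eta).
  by rewrite !ipE wf// opprK.
rewrite w0.
move: eP; rewrite (bigD1 i)//=.
have : 0 <= \sum_(j < d | j != i)
    sqL2 Omega (fun x => wD Omega j e x - partial j eta x).
  by apply: sumr_ge0 => j _; rewrite sqL2E ip_ge0.
move=> S0 eP q1 q2.
have arith (X Y y z w s t r : R) : 0 <= r -> s + (t + r) < a ^+ 2 ->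
    0 <= a ^+ 2 * Y + 2 * a * (z - w) + t ->
    0 <= a ^+ 2 * X + 2 * a * (y - - w) + s ->
    0 < a ^+ 2 * (X + Y + 1) + 2 * a * (y + z) by clear; nra.
have := arith _ _ _ _ _ _ _ _ S0 eP q1 q2; rewrite -/C -/A.
rewrite /a.
have -> : (- A / C) ^+ 2 * C + 2 * (- A / C) * A = - (A ^+ 2 / C).
  by field; apply/eqP; lra.
rewrite oppr_gt0; apply/negP; rewrite -leNgt divr_ge0 ?sqr_ge0//; lra.
Qed.

End weak_derivatives.

Opaque wD.

(** * Velocity fields and the weighted norm *)

Section fields.
Context {R : realType} {d : nat}.
Local Notation E := 'rV[R]_d.
Local Notation leb := (@lebesgue_rV R d).
Variable Omega : set E.
Hypothesis oO : open Omega.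
Hypothesis bO : bounded_set Omega.
Implicit Types u v w phi : E -> E.
Local Notation ip := (ip Omega).
Local Notation L2 := (L2 Omega).
Local Notation wD := (wD Omega).

Lemma entryB u v i : entry (u - v) ord0 i =
  (fun x => entry u ord0 i x - entry v ord0 i x).
Proof. by apply/funext => x; rewrite /entry !mxE. Qed.

Lemma entry_gradp (q : E -> R) i : entry (gradp Omega q) ord0 i = wD i q.
Proof. by apply/funext => x; rewrite /entry mxE. Qed.

Lemma entry_grad v i j : entry (grad Omega v) i j = wD j (entry v ord0 i).
Proof. by apply/funext => x; rewrite /entry mxE. Qed.

Lemma innerE m n (F G : E -> 'M[R]_(m, n)) : L2f Omega F -> L2f Omega G ->
  inner Omega F G = \sum_i \sum_j ip (entry F i j) (entry G i j).
Proof.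
move=> LF LG; have iFG i j := L2M_integrable oO (LF i j) (LG i j).
rewrite /inner (Rintegral_sum oO _ (fun i => (Rintegral_sum oO _ (iFG i)).1)).2.
by apply: eq_bigr => i _; rewrite (Rintegral_sum oO _ (iFG i)).2.
Qed.

Lemma inner_rV u v : L2f Omega u -> L2f Omega v ->
  inner Omega u v = \sum_i ip (entry u ord0 i) (entry v ord0 i).
Proof. by move=> Lu Lv; rewrite innerE// big_ord1. Qed.

Lemma norm2_sqr m n (F : E -> 'M[R]_(m, n)) :
  norm2 Omega F ^+ 2 = inner Omega F F.
Proof.
rewrite /norm2 sqr_sqrtr//; apply: Rintegral_ge0 => x _.
by apply: sumr_ge0 => i _; apply: sumr_ge0 => j _; rewrite -expr2 sqr_ge0.
Qed.

Lemma H1f_L2f v : H1f Omega v -> L2f Omega v.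
Proof. by move=> Hv i j; rewrite (ord1 i); exact/H1_L2/Hv. Qed.

Lemma L2f_gradp q : H1 Omega q -> L2f Omega (gradp Omega q).
Proof. by move=> Hq i j; rewrite (ord1 i) entry_gradp; exact: L2_wD. Qed.

Lemma H2f_H1f v : H2f Omega v -> H1f Omega v.
Proof. by move=> Hv i; have [] := Hv i. Qed.

Lemma H1fB u v : H1f Omega u -> H1f Omega v -> H1f Omega (u - v).
Proof. by move=> Hu Hv i; rewrite entryB; exact: H1B. Qed.

Lemma H2fB u v : H2f Omega u -> H2f Omega v -> H2f Omega (u - v).
Proof. by move=> Hu Hv i; rewrite entryB; exact: H2B. Qed.

Lemma no_slipB u v : no_slip Omega u -> no_slip Omega v -> no_slip Omega (u - v).
Proof. by move=> Hu Hv i; rewrite entryB; exact: H10B. Qed.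

Lemma wD_entryB u v i j : H1f Omega u -> H1f Omega v ->
  wD j (entry (u - v) ord0 i) =
  (fun x => wD j (entry u ord0 i) x - wD j (entry v ord0 i) x)
    %[ae leb in Omega].
Proof. by move=> Hu Hv; rewrite entryB; exact: wDB. Qed.

Lemma ae_rowP u v :
  (forall i, entry u ord0 i = entry v ord0 i %[ae leb in Omega]) ->
  u = v %[ae leb in Omega].
Proof.
move=> uv; have := filter_forall (ae_filter_ringOfSetsType leb) uv.
apply: filterS => x H Ox; apply/rowP => i; exact: H.
Qed.

Lemma entry_ae u v i : u = v %[ae leb in Omega] ->
  entry u ord0 i = entry v ord0 i %[ae leb in Omega].
Proof. by apply: filterS => x H Ox; rewrite /entry H. Qed.

Lemma inner_eq0 u : L2f Omega u -> inner Omega u u = 0 ->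
  u = (fun=> 0) %[ae leb in Omega].
Proof.
move=> Lu; rewrite inner_rV// => /eqP.
rewrite psumr_eq0; last by move=> i _; exact: ip_ge0.
move=> /allP u0; apply: ae_rowP => i.
have := ip_eq0 oO (Lu ord0 i) (eqP (u0 i (mem_index_enum i))).
by apply: filterS => x H Ox; rewrite H// /entry mxE.
Qed.

(** The inner product whose norm is [wnorm]. *)
Definition energy (nu dt : R) u v : R :=
  \sum_i ip (entry u ord0 i) (entry v ord0 i) + dt * nu *
  \sum_i \sum_j ip (wD j (entry u ord0 i)) (wD j (entry v ord0 i)).

Lemma wnorm_sqr (nu dt : R) v : 0 <= nu -> 0 <= dt -> H1f Omega v ->
  wnorm Omega nu dt v ^+ 2 = energy nu dt v v.
Proof.
move=> nu0 dt0 Hv; rewrite /wnorm sqr_sqrtr; last first.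
  apply: addr_ge0; first exact: sqr_ge0.
  by apply: mulr_ge0; [exact: mulr_ge0|exact: sqr_ge0].
rewrite !norm2_sqr inner_rV; [|exact: H1f_L2f..].
rewrite innerE; [|by move=> i j; rewrite entry_grad; exact: L2_wD..].
rewrite /energy; congr (_ + _ * _).
by apply: eq_bigr => i _; apply: eq_bigr => j _; rewrite entry_grad.
Qed.

(** The square of u - w = (u - v) + (v - w), expanded.  The gradients add up
    only almost everywhere. *)
Lemma energy_expand (nu dt : R) u v w : H1f Omega u -> H1f Omega v -> H1f Omega w ->
  energy nu dt (u - w) (u - w) = energy nu dt (u - v) (u - v)
    + 2 * energy nu dt (v - w) (u - v) + energy nu dt (v - w) (v - w).
Proof.
move=> Hu Hv Hw.
have Huv := H1fB Hu Hv; have Hvw := H1fB Hv Hw; have Huw := H1fB Hu Hw.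
have eE i : ip (entry (u - w) ord0 i) (entry (u - w) ord0 i) =
    ip (entry (u - v) ord0 i) (entry (u - v) ord0 i)
    + 2 * ip (entry (v - w) ord0 i) (entry (u - v) ord0 i)
    + ip (entry (v - w) ord0 i) (entry (v - w) ord0 i).
  rewrite -(ip_sqrD oO (H1_L2 (Huv i)) (H1_L2 (Hvw i))).
  have -> : entry (u - w) ord0 i =
      fun x => entry (u - v) ord0 i x + entry (v - w) ord0 i x => //.
  by apply/funext => x; rewrite !entryB; ring.
have gE i j : ip (wD j (entry (u - w) ord0 i)) (wD j (entry (u - w) ord0 i)) =
    ip (wD j (entry (u - v) ord0 i)) (wD j (entry (u - v) ord0 i))
    + 2 * ip (wD j (entry (v - w) ord0 i)) (wD j (entry (u - v) ord0 i))
    + ip (wD j (entry (v - w) ord0 i)) (wD j (entry (v - w) ord0 i)).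
  rewrite -(ip_sqrD oO (L2_wD j (Huv i)) (L2_wD j (Hvw i))).
  apply: (ip_self_ae oO (L2_wD j (Huw i))).
    by apply: L2D => //; exact: L2_wD.
  apply: filterS3 (wD_entryB i j Hu Hv) (wD_entryB i j Hv Hw)
    (wD_entryB i j Hu Hw) => x A B C Ox.
  by rewrite A// B// C//; ring.
have sumE (p q r : 'I_d -> R) :
    \sum_i (p i + 2 * q i + r i) = \sum_i p i + 2 * \sum_i q i + \sum_i r i.
  by rewrite !big_split/= -mulr_sumr.
have eS := etrans (eq_bigr _ (fun i _ => eE i)) (sumE _ _ _).
have gS := etrans (eq_bigr _ (fun i _ =>
  etrans (eq_bigr _ (fun j _ => gE i j)) (sumE _ _ _))) (sumE _ _ _).
have arith (a p q r a' p' q' r' : R) :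
    a = p + 2 * q + r -> a' = p' + 2 * q' + r' ->
    a + dt * nu * a' = p + dt * nu * p' + 2 * (q + dt * nu * q')
      + (r + dt * nu * r') by move=> -> ->; ring.
exact: arith eS gS.
Qed.

End fields.

(** * The difference of the two steps *)

Section nudging.
Context {R : realType} {d : nat}.
Local Notation E := 'rV[R]_d.
Local Notation leb := (@lebesgue_rV R d).
Variable Omega : set E.
Hypothesis oO : open Omega.
Hypothesis bO : bounded_set Omega.
Implicit Types u v w : E -> E.
Local Notation ip := (ip Omega).
Local Notation wD := (wD Omega).
Local Notation L2 := (L2 Omega).

Lemma wD_entry_ae v w i j : H1f Omega v -> H1f Omega w ->
  v = w %[ae leb in Omega] -> wD j (entry v ord0 i) = wD j (entry w ord0 i).
Proof.
move=> Hv Hw vw; apply: wD_ae => //; [exact/H1_L2|exact/H1_L2|exact: entry_ae].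
Qed.

Lemma advect_ae v w : H1f Omega v -> H1f Omega w ->
  v = w %[ae leb in Omega] ->
  advect Omega v v = advect Omega w w %[ae leb in Omega].
Proof.
move=> Hv Hw vw; apply: filterS (vw) => x xvw Ox.
apply/rowP => i; rewrite !mxE; apply: eq_bigr => j _; rewrite xvw//.
by rewrite (wD_entry_ae i j Hv Hw vw).
Qed.

Lemma laplacian_ae v w : H1f Omega v -> H1f Omega w ->
  v = w %[ae leb in Omega] -> laplacian Omega v = laplacian Omega w.
Proof.
move=> Hv Hw vw; apply/funext => x; apply/rowP => i; rewrite [LHS]mxE [RHS]mxE.
by apply: eq_bigr => j _; rewrite (wD_entry_ae i j Hv Hw vw).
Qed.

Definition lap (f : E -> R) : E -> R := fun x => \sum_j wD j (wD j f) x.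

Lemma L2_lap f : H2 Omega f -> L2 (lap f).
Proof. by move=> [_ Hf]; apply: L2_sum => // j; exact: L2_wD. Qed.

Lemma green f e : H2 Omega f -> H10 Omega e ->
  ip (lap f) e = - \sum_j ip (wD j f) (wD j e).
Proof.
move=> [_ H2f] He; have Le := H1_L2 (H10_H1 He).
rewrite ip_suml//; last by move=> j; exact: L2_wD.
by rewrite -sumrN; apply: eq_bigr => j _; exact: ibp_H10.
Qed.

(** After integration by parts, only the divergence of [e] is left. *)
Lemma pressure_orthogonal (q : E -> R) e : H1 Omega q -> no_slip Omega e ->
  divergence_free Omega e -> \sum_i ip (wD i q) (entry e ord0 i) = 0.
Proof.
move=> Hq He De.
have He1 i := H10_H1 (He i).
under eq_bigr do rewrite ibp_H10// ipC.
rewrite sumrN -ip_suml//; [|by move=> i; exact: L2_wD|exact: H1_L2].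
rewrite (ip_ae oO _ (L2_0 oO) (H1_L2 Hq) De); last by apply: L2_sum => // i; exact: L2_wD.
rewrite ipE; under eq_Rintegral do rewrite mul0r.
by rewrite Rintegral_cst ?mul0r ?oppr0//; exact: open_measurable_rV.
Qed.

Lemma divergence_freeB u v : H1f Omega u -> H1f Omega v ->
  divergence_free Omega u -> divergence_free Omega v ->
  divergence_free Omega (u - v).
Proof.
move=> Hu Hv Du Dv.
have := filter_forall (ae_filter_ringOfSetsType leb) (fun i => wD_entryB oO bO i i Hu Hv).
apply: filterS3 Du Dv => x U V W Ox.
rewrite /divergence; under eq_bigr do rewrite W//.
by rewrite big_split/= sumrN -/(divergence Omega u x) -/(divergence Omega v x) U// V// subrr.
Qed.

Section one_step.
Variables (nu dt chi : R) (IH : (E -> E) -> E -> E).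
Variables (f1 u1 v0 w0 v1 w1 : E -> E) (q1 r1 : E -> R).
Hypotheses (dt_gt0 : 0 < dt) (chi_gt0 : 0 < chi).
Hypotheses (hv0 : H1f Omega v0) (hw0 : H1f Omega w0).
Hypothesis v0w0 : v0 = w0 %[ae leb in Omega].
Hypothesis hw1 : plain_step Omega nu dt f1 w0 w1 q1.
Hypothesis hv1 : nudged_step Omega nu dt chi IH f1 u1 v0 v1 r1.
Hypotheses (Hu1 : H2f Omega u1) (Nu1 : no_slip Omega u1).
Hypothesis Du1 : divergence_free Omega u1.
Hypothesis LI : L2f Omega (IH (u1 - v1)).

(** The difference of the two momentum equations. *)
Lemma nudging_term : (fun x => chi *: IH (u1 - v1) x) =
  (fun x => dt^-1 *: (v1 - w1) x
    - nu *: (laplacian Omega v1 x - laplacian Omega w1 x)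
    + (gradp Omega r1 x - gradp Omega q1 x)) %[ae leb in Omega].
Proof.
have arith (t m a b c A X L L' r q : R) :
    t * (a - c) + A - m * L - X + r = t * (b - c) + A - m * L' + q ->
    X = t * (a - b) - m * (L - L') + (r - q) by lra.
have [_ _ _ _ Ew] := hw1; have [_ _ _ _ Ev] := hv1.
have Ea := advect_ae hv0 hw0 v0w0.
apply: filterS2 (filterI Ew Ev) (filterI v0w0 Ea) => x [Hw Hv] [H0 Ha] Ox.
move: (Hw Ox) (Hv Ox); rewrite H0// Ha// => <- /rowP Hx.
apply/rowP => i; move: (Hx i); rewrite !mxE.
exact: arith.
Qed.

Lemma nudging_entry i :
  (fun x => chi * entry (IH (u1 - v1)) ord0 i x) =
  (fun x => dt^-1 * entry (v1 - w1) ord0 i x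
    - nu * (lap (entry v1 ord0 i) x - lap (entry w1 ord0 i) x)
    + (wD i r1 x - wD i q1 x)) %[ae leb in Omega].
Proof.
rewrite entryB; apply: filterS nudging_term => x H Ox.
by move/rowP: (H Ox) => /(_ i); rewrite !mxE.
Qed.

(** [nudging_term] tested with [u1 - v1]. *)
Lemma nudging_energy :
  energy Omega nu dt (v1 - w1) (u1 - v1) =
  dt * chi * inner Omega (IH (u1 - v1)) (u1 - v1).
Proof.
have sum_arith (p q r s h : 'I_d -> R) :
    (forall i, chi * h i = dt^-1 * p i + nu * q i + (r i - s i)) ->
    \sum_i r i = 0 -> \sum_i s i = 0 ->
    \sum_i p i + dt * nu * \sum_i q i = dt * chi * \sum_i h i.
  move=> hE r0 s0; rewrite -[RHS]mulrA [chi * _]mulr_sumr (eq_bigr _ (fun i _ => hE i)).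
  rewrite !big_split/= sumrN r0 s0 subrr addr0 -!mulr_sumr mulrDr !mulrA.
  by rewrite divff ?gt_eqF// mul1r.
have [Hw Nw Dw Hq _] := hw1; have [Hv Nv Dv Hr _] := hv1.
have Hu' := H2f_H1f Hu1; have Hv' := H2f_H1f Hv; have Hw' := H2f_H1f Hw.
have Huv := H1fB oO bO Hu' Hv'; have Hvw := H1fB oO bO Hv' Hw'.
have Ne := no_slipB oO bO Nu1 Nv.
have De := divergence_freeB Hu' Hv' Du1 Dv.
have Le i := H1_L2 (Huv i).
rewrite inner_rV//; last exact: H1f_L2f.
have IE i : chi * ip (entry (IH (u1 - v1)) ord0 i) (entry (u1 - v1) ord0 i) =
    dt^-1 * ip (entry (v1 - w1) ord0 i) (entry (u1 - v1) ord0 i)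
    + nu * \sum_j ip (wD j (entry (v1 - w1) ord0 i)) (wD j (entry (u1 - v1) ord0 i))
    + (ip (wD i r1) (entry (u1 - v1) ord0 i) - ip (wD i q1) (entry (u1 - v1) ord0 i)).
  have Lap a : H2f Omega a -> L2 (lap (entry a ord0 i)) by move=> Ha; exact: L2_lap.
  have Ld := H1_L2 (Hvw i).
  have Lr := L2_wD i Hr; have Lq := L2_wD i Hq.
  have Lv := Lap _ Hv; have Lw := Lap _ Hw.
  have Lvw := L2B oO Lv Lw; have Lrq := L2B oO Lr Lq.
  have Ldt := L2Z oO dt^-1 Ld; have Lnu := L2Z oO nu Lvw.
  have LI' := LI ord0 i.
  rewrite -ipZl// (ip_ae oO _ _ _ (nudging_entry i))//; last 2 first.
  - exact: L2Z.
  - by apply: L2D => //; exact: L2B.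
  rewrite (ipDl oO (L2B oO Ldt Lnu) Lrq (Le i)) (ipBl oO Ldt Lnu (Le i)).
  rewrite (ipZl oO dt^-1 Ld (Le i)) (ipZl oO nu Lvw (Le i)).
  rewrite (ipBl oO Lv Lw (Le i)) (ipBl oO Lr Lq (Le i)).
  have gradB : \sum_j ip (wD j (entry (v1 - w1) ord0 i)) (wD j (entry (u1 - v1) ord0 i)) =
      \sum_j ip (wD j (entry v1 ord0 i)) (wD j (entry (u1 - v1) ord0 i))
      - \sum_j ip (wD j (entry w1 ord0 i)) (wD j (entry (u1 - v1) ord0 i)).
    rewrite -sumrB; apply: eq_bigr => j _.
    have Lvj := L2_wD j (Hv' i); have Lwj := L2_wD j (Hw' i).
    have Lej := L2_wD j (Huv i).
    rewrite -(ipBl oO Lvj Lwj Lej).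
    exact: (ip_ae oO (L2_wD j (Hvw i)) (L2B oO Lvj Lwj) Lej
      (wD_entryB oO bO i j Hv' Hw')).
  have arith (a pv pw sv sw t k : R) : t = sv - sw -> pv = - sv -> pw = - sw ->
    a - nu * (pv - pw) + k = a + nu * t + k by move=> -> -> ->; ring.
  exact: arith gradB (green (Hv i) (Ne i)) (green (Hw i) (Ne i)).
exact: sum_arith IE (pressure_orthogonal Hr Ne De) (pressure_orthogonal Hq Ne De).
Qed.

(** When the two steps agree, [nudging_term] reduces to a pressure gradient. *)
Lemma nudging_orthogonal : v1 = w1 %[ae leb in Omega] ->
  forall z, solenoidal Omega z -> inner Omega (IH (u1 - v1)) z = 0.
Proof.
have sum_arith (r s h : 'I_d -> R) : (forall i, chi * h i = r i - s i) ->
    \sum_i r i = 0 -> \sum_i s i = 0 -> \sum_i h i = 0.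
  move=> hE r0 s0; apply: (mulfI (lt0r_neq0 chi_gt0)).
  by rewrite mulr_sumr (eq_bigr _ (fun i _ => hE i)) sumrB r0 s0 subrr mulr0.
have [Hw _ _ Hq _] := hw1; have [Hv _ _ Hr _] := hv1 => v1w1 z [Lz zP].
have lapE := laplacian_ae (H2f_H1f Hv) (H2f_H1f Hw) v1w1.
have grad0 q : H1 Omega q -> \sum_i ip (wD i q) (entry z ord0 i) = 0.
  move=> Hq'; have := zP _ Hq'; rewrite (inner_rV oO Lz (L2f_gradp Hq')); apply: etrans.
  by apply: eq_bigr => i _; rewrite entry_gradp ipC.
rewrite (inner_rV oO LI Lz); apply: (sum_arith _ _ _ _ (grad0 _ Hr) (grad0 _ Hq)) => i.
have Lr := L2_wD i Hr; have Lq := L2_wD i Hq; have Lzi := Lz ord0 i.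
have LI' := LI ord0 i.
rewrite -(ipZl oO _ LI' Lzi) -(ipBl oO Lr Lq Lzi).
apply: (ip_ae oO (L2Z oO _ LI') (L2B oO Lr Lq) Lzi).
apply: filterS2 nudging_term v1w1 => x H Hx Ox.
have vw0 : (v1 - w1) x = 0 by rewrite -[LHS]/(v1 x - w1 x) (Hx Ox) subrr.
move: (H Ox); rewrite lapE vw0 subrr !scaler0 subr0 add0r => /rowP/(_ i).
by rewrite !mxE.
Qed.

End one_step.
End nudging.

(** * The comparison of the two steps *)

Theorem theorem2p1 (R : realType) (d : nat) (hd : d = 2%N \/ d = 3%N)
  (Omega : set 'rV[R]_d) (hOmega : bounded_regular_domain Omega)
  (nu dt T : R) (nu_gt0 : 0 < nu) (dt_gt0 : 0 < dt)
  (f u : R -> 'rV[R]_d -> 'rV[R]_d) (p : R -> 'rV[R]_d -> R)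
  (hu : navier_stokes Omega nu T f u p)
  (I : R -> ('rV[R]_d -> 'rV[R]_d) -> 'rV[R]_d -> 'rV[R]_d)
  (H : R) (H_gt0 : 0 < H) (hI : nonnegative_observation Omega (I H))
  (chi : R) (chi_gt0 : 0 < chi)
  (n : nat) (t1 := n.+1%:R * dt) (ht1 : t1 <= T)
  (v0 w0 v1 w1 : 'rV[R]_d -> 'rV[R]_d) (r1 q1 : 'rV[R]_d -> R)
  (hv0 : H1f Omega v0) (hw0 : H1f Omega w0)
  (hw1 : plain_step Omega nu dt (f t1) w0 w1 q1)
  (hv1 : nudged_step Omega nu dt chi (I H) (f t1) (u t1) v0 v1 r1)
  (hv0w0 : v0 = w0 %[ae @lebesgue_rV R d in Omega]) :
  [/\ ~ (v1 = w1 %[ae @lebesgue_rV R d in Omega]) ->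
      wnorm Omega nu dt (u t1 - v1) < wnorm Omega nu dt (u t1 - w1),
      v1 = w1 %[ae @lebesgue_rV R d in Omega] ->
      (forall z, solenoidal Omega z -> inner Omega (I H (u t1 - v1)) z = 0) /\
      (solenoidal Omega (I H (u t1 - v1)) ->
       I H (u t1 - v1) = (fun=> 0) %[ae @lebesgue_rV R d in Omega])
    & wnorm Omega nu dt (u t1 - v1) ^+ 2
      + 2 * dt * chi * inner Omega (I H (u t1 - v1)) (u t1 - v1)
      + wnorm Omega nu dt (v1 - w1) ^+ 2
      = wnorm Omega nu dt (u t1 - w1) ^+ 2].
Proof.
have [oO _ _ bO _] := hOmega.
have t1_gt0 : 0 < t1 by rewrite mulr_gt0.
have [|Hu Nu Du _ _] := hu t1; first by rewrite t1_gt0.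
have [Hw Nw Dw _ _] := hw1; have [Hv Nv Dv _ _] := hv1.
have [LI I0] := hI _ (H2fB oO bO Hu Hv) (no_slipB oO bO Nu Nv).
have Hu' := H2f_H1f Hu; have Hv' := H2f_H1f Hv; have Hw' := H2f_H1f Hw.
have nu0 := ltW nu_gt0; have dt0 := ltW dt_gt0.
have identity : wnorm Omega nu dt (u t1 - v1) ^+ 2
    + 2 * dt * chi * inner Omega (I H (u t1 - v1)) (u t1 - v1)
    + wnorm Omega nu dt (v1 - w1) ^+ 2 = wnorm Omega nu dt (u t1 - w1) ^+ 2.
  have arith (A B C a b c k X : R) : A = a -> B = b -> C = c ->
      c = a + 2 * k + b -> k = dt * chi * X -> A + 2 * dt * chi * X + B = C.
    by move=> -> -> -> -> ->; ring.
  have wE := @wnorm_sqr _ _ Omega oO nu dt _ nu0 dt0.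
  apply: arith (energy_expand oO bO nu dt Hu' Hv' Hw')
    (nudging_energy oO bO dt_gt0 hv0 hw0 hv0w0 hw1 hv1 Hu Nu Du LI).
  - exact/wE/H1fB.
  - exact/wE/H1fB.
  - exact/wE/H1fB.
split=> //; last first.
  move=> v1w1.
  have orth := nudging_orthogonal oO bO chi_gt0 hv0 hw0 hv0w0 hw1 hv1 LI v1w1.
  by split=> // sol; apply: (inner_eq0 oO LI); exact: orth.
move=> v1w1.
have wn0 : 0 <= wnorm Omega nu dt (u t1 - w1) by exact: sqrtr_ge0.
have vn0 : 0 <= wnorm Omega nu dt (u t1 - v1) by exact: sqrtr_ge0.
have pos : 0 < wnorm Omega nu dt (v1 - w1) ^+ 2.
  rewrite lt0r sqr_ge0 andbT; apply/negP => /eqP N0; apply: v1w1.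
  have Hvw := H1fB oO bO Hv' Hw'.
  have : inner Omega (v1 - w1) (v1 - w1) = 0.
    move: N0; rewrite (wnorm_sqr oO nu0 dt0 Hvw) /energy.
    rewrite -(inner_rV oO (H1f_L2f Hvw) (H1f_L2f Hvw)) => /eqP.
    rewrite paddr_eq0.
    - by move=> /andP[/eqP].
    - by rewrite -norm2_sqr sqr_ge0.
    - apply: mulr_ge0; first exact: mulr_ge0.
      by apply: sumr_ge0 => i _; apply: sumr_ge0 => j _; exact: ip_ge0.
  move=> /(inner_eq0 oO (H1f_L2f Hvw)).
  apply: filterS => x H0 Ox; apply/eqP; rewrite -subr_eq0; apply/eqP.
  exact: H0.
have arith (A B X C : R) : 0 <= A -> 0 <= C -> 0 <= X -> 0 < B ->
    A ^+ 2 + X + B = C ^+ 2 -> A < C.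
  move=> A0 C0 X0 B0 E; rewrite -ltr_sqr ?nnegrE// -E -addrA ltrDl.
  exact: ltr_wpDl.
apply: arith vn0 wn0 _ pos identity.
by apply: mulr_ge0 => //; rewrite !mulr_ge0// ltW.
Qed.
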